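(* Let $n = q_1 q_2 \cdots q_k m$, where $k \geq 1$, $m$ is a positive integer, and $q_1 < q_2 < \cdots < q_k$ is an increasing sequence of primes with $q_1 = 2$ and $q_{i+1} \leq \sigma(q_1 \cdots q_i) + 1$ for all $1 \leq i < k$. If none of $q_1, \ldots, q_k$ divides $m$ and \[ \sigma(q_1 \cdots q_k) < n < \sigma(q_1 \cdots q_k)\,(\sigma(\mathrm{rad}(m)) - 1), \] then \[ p_{\mathrm{dsd}}(n) \geq \left\lfloor \frac{\sigma(q_1 \cdots q_k)}{\sigma(\mathrm{rad}(m)) - 1} \right\rfloor^{d(\mathrm{rad}(m)) - 1}. \]
   Context: For a positive integer $n$, $p_{\mathrm{dsd}}(n)$ is the number of partitions of $n$ into distinct squarefree divisors of $n$, i.e. the number of sets of squarefree positive divisors of $n$ whose elements sum to $n$. $\sigma(m)$ is the sum of the positive divisors of $m$, $d(m)$ is the number of positive divisors of $m$, and $\mathrm{rad}(m)$ is the radical of $m$, i.e. the largest squarefree divisor of $m$. *)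

(* Defs.v *)
From mathcomp Require Import all_boot.

Set Implicit Arguments.
Unset Strict Implicit.
Unset Printing Implicit Defensive.

Definition squarefree (n : nat) : bool :=
  (0 < n) && all (fun d => (d ^ 2 %| n) ==> (d == 1)) (divisors n).

Definition sigma (n : nat) : nat := \sum_(d <- divisors n) d.

Definition num_divisors (n : nat) : nat := size (divisors n).

Definition rad (n : nat) : nat := \max_(d <- divisors n | squarefree d) d.

(* For n > 0 every divisor of n lies in {1, ..., n}, so a set of divisors of n
   is encoded as a subset of 'I_n.+1 (0 does not divide n). *)
Definition p_dsd (n : nat) : nat :=
  #|[set A : {set 'I_n.+1} |
      [forall d in A, (d %| n) && squarefree d] && (\sum_(d in A) d == n)]|.

(* Main.v *)
Require Import Defs.
From mathcomp Require Import all_boot.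
From mathcomp Require Import zify.

(** Write [N] for the product of the [q i], [S = sigma N], [r = rad m] and
    [T = sigma r - 1], the sum of the divisors of [r] other than [1].

    The gap condition makes [N] a practical number: every [s <= S] is a sum of
    distinct divisors of [N] ([practical_mul_prime], [prime_chain_prod]).
    Since [N] and [r] are coprime and squarefree, the products [e * d] with
    [e %| N] and [d %| r] are distinct squarefree divisors of [n].  So each
    way of writing [n] as the sum of [a d * d] over the divisors [d] of [r],
    with coefficients [a d <= S], expands into a partition of [n] into distinct
    squarefree divisors: write each [a d] as a sum of distinct divisors of [N].
    Different coefficient vectors give different partitions, because [a d] is
    recovered from the parts of the form [e * d].

    It remains to count coefficient vectors.  Let every [a d] with [d != 1] run
    freely over one window of [S %/ T] consecutive values.  The sum of the
    corresponding [a d * d] then varies by less than [S], so the window can be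
    placed ([coef_window]) such that this sum always lies between [n - S] and
    [n]; the coefficient of [d = 1] makes up the difference.  This gives
    [S %/ T] choices for each of the [num_divisors r - 1] divisors [d != 1]
    ([p_dsd_ge]). *)

Set Implicit Arguments.
Unset Strict Implicit.

(** * Squarefree numbers *)

Lemma squarefreeP a :
  reflect (0 < a /\ forall d, d ^ 2 %| a -> d = 1) (squarefree a).
Proof.
apply: (iffP andP) => -[a_gt0].
  move=> /allP sq; split=> // d d2a; apply/eqP.
  have da : d %| a by apply: dvdn_trans d2a; rewrite dvdn_exp.
  by move: (sq d); rewrite -dvdn_divisors // d2a => /(_ da).
move=> sq; split=> //; apply/allP => d _; apply/implyP => d2a.
exact/eqP/sq.
Qed.

Lemma squarefree_dvd a b : a %| b -> squarefree b -> squarefree a.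
Proof.
move=> ab /squarefreeP[b_gt0 sq]; apply/squarefreeP.
by split=> [|d d2a]; [apply: dvdn_gt0 ab | apply: sq; apply: dvdn_trans ab].
Qed.

Lemma squarefree_mul a b :
  coprime a b -> squarefree a -> squarefree b -> squarefree (a * b).
Proof.
move=> co_ab /squarefreeP[a_gt0 sq_a] /squarefreeP[b_gt0 sq_b].
apply/squarefreeP; split=> [|d d2ab]; first by rewrite muln_gt0 a_gt0.
(* The square of [gcdn d a] divides [a * b] and is coprime to [b]. *)
have gcd1 : gcdn d a = 1.
  apply: sq_a; rewrite -(@Gauss_dvdl _ a b).
    by apply: dvdn_trans d2ab; rewrite dvdn_exp2r // dvdn_gcdl.
  by rewrite coprimeXl // (coprime_dvdl _ co_ab) // dvdn_gcdr.
apply: sq_b; rewrite -(@Gauss_dvdr _ a b) //.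
by rewrite coprimeXl // /coprime gcd1.
Qed.

Lemma squarefree_prime p : prime p -> squarefree p.
Proof.
move=> p_pr; apply/squarefreeP; split=> [|d d2p]; first exact: prime_gt0.
have dp : d %| p by apply: dvdn_trans d2p; rewrite dvdn_exp.
case/primeP: (p_pr) => p_gt1 /(_ _ dp)/orP[/eqP //|/eqP dE].
by move: (dvdn_leq (prime_gt0 p_pr) d2p); rewrite dE; nia.
Qed.

Lemma rad_squarefree_dvd m : 0 < m -> (rad m %| m) && squarefree (rad m).
Proof.
move=> m_gt0.
(* The maximum over an empty range is [0], so [0] is excluded only afterwards. *)
pose K x := (x == 0) || (x %| m) && squarefree x.
have KP : K (rad m).
  rewrite /rad big_seq_cond.
  apply: (big_ind K) => [||d /andP[dm sq]]; first by [].
    by move=> x y Kx Ky; rewrite /maxn; case: ifP.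
  by rewrite /K dvdn_divisors // dm sq orbT.
have sq1 : squarefree 1.
  by apply/squarefreeP; split=> // d; rewrite dvdn1 => /eqP; nia.
have rad_gt0 : 0 < rad m.
  exact: (@leq_bigmax_seq _ (divisors m) squarefree id 1 (divisor1 m) sq1).
by move: KP; rewrite /K eqn0Ngt rad_gt0.
Qed.

(** * Divisor sums of coprime products *)

(** By coprimality [e] is recovered from [e * d] as its gcd with [a], so the
    products of divisors are distinct. *)
Lemma perm_divisors_mul a b : 0 < a -> 0 < b -> coprime a b ->
  perm_eq (divisors (a * b)) [seq e * d | d <- divisors b, e <- divisors a].
Proof.
move=> a_gt0 b_gt0 co_ab.
have ab_gt0 : 0 < a * b by rewrite muln_gt0 a_gt0.
apply: uniq_perm; first exact: divisors_uniq.
  apply: allpairs_uniq; [exact: divisors_uniq | exact: divisors_uniq|].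
  have gcdE d e : d %| b -> e %| a -> gcdn a (e * d) = e.
    move=> db ea; rewrite Gauss_gcdl; first exact/gcdn_idPr.
    exact: coprime_dvdr db co_ab.
  move=> [d e] [d' e'] /allpairsP[[? ?] [/= + + [-> ->]]].
  rewrite -!dvdn_divisors // => db ea.
  move=> /allpairsP[[? ?] [/= + + [-> ->]]].
  rewrite -!dvdn_divisors // => d'b e'a /= eq_ed.
  have eqe := congr1 (gcdn a) eq_ed; rewrite !gcdE // in eqe.
  move/eqP: eq_ed; rewrite -eqe eqn_pmul2l ?(dvdn_gt0 a_gt0) // => /eqP ->.
  by [].
move=> x; rewrite -dvdn_divisors //; apply/idP/allpairsP.
  move=> xab; have g_gt0 : 0 < gcdn x a by rewrite gcdn_gt0 a_gt0 orbT.
  exists (x %/ gcdn x a, gcdn x a); split=> /=; last 1 first.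
  - by rewrite mulnC divnK // dvdn_gcdl.
  - rewrite -dvdn_divisors // -(@Gauss_dvdr _ (a %/ gcdn x a)).
      rewrite -(dvdn_pmul2l g_gt0) mulnA.
      by rewrite ![gcdn x a * (_ %/ _)]mulnC !divnK ?dvdn_gcdl ?dvdn_gcdr.
    rewrite /coprime -(eqn_pmul2r g_gt0) muln_gcdl.
    by rewrite !divnK ?dvdn_gcdl ?dvdn_gcdr // mul1n.
  - by rewrite -dvdn_divisors // dvdn_gcdr.
case=> -[d e] /= [+ + ->]; rewrite -!dvdn_divisors // => db ea.
exact: dvdn_mul.
Qed.

Lemma sum_divisors_mul a b (F : nat -> nat) :
  0 < a -> 0 < b -> coprime a b ->
  \sum_(x <- divisors (a * b)) F x =
  \sum_(d <- divisors b) \sum_(e <- divisors a) F (e * d).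
Proof.
move=> a_gt0 b_gt0 co_ab.
by rewrite (perm_big _ (perm_divisors_mul a_gt0 b_gt0 co_ab)) big_allpairs_dep.
Qed.

Lemma sum_divisors_prime p (F : nat -> nat) : prime p ->
  \sum_(d <- divisors p) F d = F 1 + F p.
Proof.
move=> p_pr.
have perm_p : perm_eq (divisors p) [:: 1; p].
  apply: uniq_perm; first exact: divisors_uniq.
    by rewrite /= inE eq_sym -(negbK (p == 1)) (gtn_eqF (prime_gt1 p_pr)).
  move=> d; rewrite -dvdn_divisors ?prime_gt0 // !inE.
  apply/idP/orP; first by case/primeP: p_pr => _; move=> h /h/orP.
  by case=> /eqP ->.
by rewrite (perm_big _ perm_p) big_cons big_seq1.
Qed.

(** * Practical numbers *)

(** A set of divisors summing to [s] is encoded as a predicate [B s] filtering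
    [divisors N], which makes the summands distinct.  A single [B] serves all
    [s] at once, so that such sets can later be used without a choice
    principle. *)
Definition practical N := exists B : nat -> pred nat,
  forall s, s <= sigma N -> \sum_(e <- divisors N | B s e) e = s.

Lemma practical1 : practical 1.
Proof.
exists (fun s _ => s == 1) => s.
rewrite /sigma /= big_seq1 => s_le1; rewrite big_mkcond big_seq1.
by case: eqP; lia.
Qed.

(** Every [s <= sigma N * (1 + p)] has the form [v + p * u] with [u] and [v] at
    most [sigma N]: take [u] as large as possible.  If [u = s %/ p], then
    [v < p <= sigma N + 1]; otherwise [u = sigma N] and the bound on [s] gives
    [v <= sigma N].  Divisors of [N] summing to [v], and [p] times divisors of
    [N] summing to [u], are distinct since [p] does not divide [N]. *)
Lemma practical_mul_prime N p : 0 < N -> prime p -> ~~ (p %| N) ->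
  p <= sigma N + 1 -> practical N -> practical (N * p).
Proof.
move=> N_gt0 p_pr pN p_le [B BP].
have p_gt0 := prime_gt0 p_pr.
have co : coprime N p by rewrite coprime_sym prime_coprime.
pose u s := minn (s %/ p) (sigma N).
exists (fun s x => if p %| x then B (u s) (x %/ p) else B (s - p * u s) x).
move=> s; rewrite /sigma !sum_divisors_mul // sum_divisors_prime //.
rewrite -!big_distrl /= -/(sigma N) => s_le.
have s_divE := divn_eq s p; have s_mod := ltn_pmod s p_gt0.
rewrite big_mkcond /= sum_divisors_mul // sum_divisors_prime //.
have -> : \sum_(e <- divisors N) (if (if p %| e * 1 then B (u s) (e * 1 %/ p)
    else B (s - p * u s) (e * 1)) then e * 1 else 0) = s - p * u s.
  rewrite -[RHS]BP; last by rewrite /u; nia.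
  rewrite [RHS]big_mkcond; apply: eq_big_seq => e.
  rewrite -dvdn_divisors // muln1 => eN.
  by rewrite (contraNF (fun pe => dvdn_trans pe eN) pN).
have -> : \sum_(e <- divisors N) (if (if p %| e * p then B (u s) (e * p %/ p)
    else B (s - p * u s) (e * p)) then e * p else 0) = u s * p.
  rewrite -[X in _ = X * p]BP; last by rewrite /u; lia.
  rewrite [in RHS]big_mkcond big_distrl /=; apply: eq_bigr => e _.
  by rewrite dvdn_mull // mulnK //; case: ifP.
by rewrite mulnC subnK // /u; nia.
Qed.

(** * Counting partitions *)

Lemma sum_ord_divisors N n (A : pred nat) : 0 < n -> N %| n ->
  \sum_(x : 'I_n.+1 | (x %| N) && A x) x = \sum_(x <- divisors N | A x) x.
Proof.
move=> n_gt0 Nn; have N_gt0 := dvdn_gt0 n_gt0 Nn.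
rewrite -(big_mkord (fun x => (x %| N) && A x) id) /=.
rewrite -big_filter -[RHS]big_filter; apply: perm_big; apply: uniq_perm.
- by rewrite filter_uniq // iota_uniq.
- by rewrite filter_uniq // divisors_uniq.
move=> x; rewrite !mem_filter mem_index_iota -dvdn_divisors //=.
case: (boolP (x %| N)) => xN; rewrite ?andbF //= andbT; apply: andb_idr => _.
exact: dvdn_leq (dvdn_trans xN Nn).
Qed.

(** The witness is the ceiling of [(n - S) / T], the least [b] satisfying the
    first bound; hence [b * T < n - S + T], and adding [S %/ T * T <= S] gives
    the second one.  The second bound says that the last value
    [b + S %/ T - 1] of the window, used for all coefficients, gives a sum
    smaller than [n]. *)
Lemma coef_window T S n : S <= n -> n < S * T ->
  exists b, n <= b * T + S /\ (b + S %/ T) * T < n + T.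
Proof.
move=> S_le n_lt; have T_gt0 : 0 < T by nia.
exists ((n - S + T.-1) %/ T).
have := divn_eq (n - S + T.-1) T; have := ltn_pmod (n - S + T.-1) T_gt0.
have := leq_trunc_div S T.
nia.
Qed.

(** The [L] to the power [num_divisors r - 1] functions [f] on the divisors
    [d != 1] of [r] embed into the partitions of [n]: [f] shifts each
    coefficient inside its window, [a f] completes the coefficients at [d = 1],
    and [sel f] selects the divisors of [N * r] that are the parts. *)
Lemma p_dsd_ge n N r : 0 < n -> N * r %| n -> squarefree N -> squarefree r ->
  coprime N r -> practical N ->
  sigma N <= n -> n < sigma N * (sigma r - 1) ->
  (sigma N %/ (sigma r - 1)) ^ (num_divisors r - 1) <= p_dsd n.
Proof.
move=> n_gt0 Nrn sqN sqr co_Nr [B BP] S_le n_lt.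
have N_gt0 : 0 < N by case/squarefreeP: sqN.
have r_gt0 : 0 < r by case/squarefreeP: sqr.
pose D := rem 1 (divisors r).
have D_uniq : uniq D by rewrite rem_uniq // divisors_uniq.
have memD d : (d \in D) = (d != 1) && (d %| r).
  by rewrite mem_rem_uniq ?divisors_uniq // inE -dvdn_divisors.
have sumD (F : nat -> nat) :
    \sum_(d <- divisors r) F d = F 1 + \sum_(d <- D) F d.
  by rewrite (big_rem 1) ?divisor1.
have TE : sigma r - 1 = \sum_(d <- D) d by rewrite /sigma (sumD id) addKn.
rewrite {}TE in n_lt *.
set T := \sum_(d <- D) d in n_lt *; set S := sigma N in S_le n_lt *.
have [b [b_lb b_ub]] := coef_window S_le n_lt.
pose L := S %/ T; rewrite -/L in b_ub *.
(* Outside [D] the default [0] of [oapp] is never looked at. *)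
pose c (f : {ffun seq_sub D -> 'I_L}) d :=
  b + oapp (fun y => nat_of_ord (f y)) 0 (insub d).
pose a f d := if d == 1 then n - \sum_(d <- D) c f d * d else c f d.
have c_val f (y : seq_sub D) : c f (ssval y) = b + f y.
  by rewrite /c; have -> : insub (ssval y) = Some y := valK y.
have c_bounds f d : d \in D -> b <= c f d < b + L.
  move=> dD; rewrite -[d]/(ssval (SeqSub dD)) c_val leq_addr ltn_add2l.
  exact: ltn_ord.
have c_sum f : n <= \sum_(d <- D) c f d * d + S /\ \sum_(d <- D) c f d * d <= n.
  have lb : b * T <= \sum_(d <- D) c f d * d.
    rewrite big_distrr /= !big_seq; apply: leq_sum => d dD.
    by rewrite leq_mul2r; case/andP: (c_bounds f d dD) => ->; rewrite orbT.
  have ub : \sum_(d <- D) c f d * d + T <= (b + L) * T.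
    rewrite big_distrr -big_split /= !big_seq; apply: leq_sum => d dD.
    rewrite -mulSnr leq_mul2r.
    by case/andP: (c_bounds f d dD) => _ ->; rewrite orbT.
  by move: b_lb b_ub lb ub; rewrite -/T; lia.
have a_le f d : d %| r -> a f d <= S.
  rewrite /a => dr; case: eqP => [_|/eqP d1]; first by have := c_sum f; lia.
  by have := c_bounds f d; rewrite memD d1 dr => /(_ isT); nia.
have a_sum f : \sum_(d <- divisors r) a f d * d = n.
  rewrite sumD /a eqxx muln1.
  rewrite [X in _ + X](_ : _ = \sum_(d <- D) c f d * d); last first.
    by apply: eq_big_seq => d; rewrite memD => /andP[/negPf -> _].
  by rewrite subnK //; case: (c_sum f).
(* A divisor of [N * r] is [e * d] with [e] and [d] its gcds with [N] and [r]. *)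
pose sel f x := B (a f (gcdn r x)) (gcdn N x).
have selE f e d : e %| N -> d %| r -> sel f (e * d) = B (a f d) e.
  move=> eN dr; rewrite /sel Gauss_gcdr 1?Gauss_gcdl.
  - by move/gcdn_idPr: eN => ->; move/gcdn_idPr: dr => ->.
  - exact: coprime_dvdr dr co_Nr.
  - by rewrite coprime_sym; apply: coprime_dvdl eN co_Nr.
have sel_sum f : \sum_(x <- divisors (N * r) | sel f x) x = n.
  rewrite big_mkcond /= sum_divisors_mul // -[RHS](a_sum f).
  apply: eq_big_seq => d; rewrite -dvdn_divisors // => dr.
  rewrite -[X in _ = X * d]BP ?a_le // [in RHS]big_mkcond big_distrl /=.
  apply: eq_big_seq => e; rewrite -dvdn_divisors // => eN.
  by rewrite selE //; case: ifP.
pose A f : {set 'I_n.+1} := [set x : 'I_n.+1 | (x %| N * r) && sel f x].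
have A_inj : injective A.
  move=> f g eqA; apply/ffunP => y; apply: val_inj => /=.
  have := valP y; rewrite /= memD => /andP[y1 yr].
  suff: a f (ssval y) = a g (ssval y).
    by rewrite /a (negPf y1) !c_val => /addnI.
  (* [a f d] is the sum of those [e %| N] for which [e * d] belongs to [A f]. *)
  rewrite -[LHS]BP ?a_le // -[RHS]BP ?a_le // big_seq_cond [RHS]big_seq_cond.
  apply: eq_bigl => e; case: (boolP (e \in _)) => //=.
  rewrite -dvdn_divisors // => eN.
  have edNr : e * ssval y %| N * r by apply: dvdn_mul.
  have lt_n : e * ssval y < n.+1.
    by apply: dvdn_leq n_gt0 (dvdn_trans edNr Nrn).
  have /setP/(_ (Ordinal lt_n)) := eqA.
  by rewrite !inE /= edNr !selE.
have cardE : #|{ffun seq_sub D -> 'I_L}| = L ^ (num_divisors r - 1).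
  by rewrite card_ffun card_ord card_seq_sub // size_rem ?divisor1 // subn1.
rewrite -cardE -(card_imset _ A_inj) /p_dsd; apply: subset_leq_card.
apply/subsetP => _ /imsetP[f _ ->]; rewrite inE; apply/andP; split.
  apply/forall_inP => x; rewrite inE => /andP[xNr _].
  rewrite (dvdn_trans xNr Nrn) /=.
  exact: squarefree_dvd xNr (squarefree_mul co_Nr sqN sqr).
apply/eqP; rewrite -[RHS](sel_sum f) -(sum_ord_divisors _ n_gt0 Nrn).
by apply: eq_bigl => x; rewrite inE.
Qed.

(** * Products of the primes [q i] *)

Lemma coprime_big_prod k (q : nat -> nat) x :
  (forall j, 1 <= j <= k -> coprime (q j) x) ->
  coprime (\prod_(1 <= j < k.+1) q j) x.
Proof.
move=> co; rewrite big_nat.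
apply: (big_ind (fun y => coprime y x)) => [|y z cy cz|j]; first exact: coprime1n.
  by rewrite coprimeMl cy.
by rewrite ltnS => /co.
Qed.

(** The primes are multiplied in one at a time, starting from the empty product
    [1], for which the gap condition is [q 1 = 2 <= sigma 1 + 1]. *)
Lemma prime_chain_prod k (q : nat -> nat) :
  (forall i, 1 <= i <= k -> prime (q i)) ->
  (forall i, 1 <= i < k -> q i < q i.+1) ->
  q 1 = 2 ->
  (forall i, 1 <= i < k -> q i.+1 <= sigma (\prod_(1 <= j < i.+1) q j) + 1) ->
  squarefree (\prod_(1 <= j < k.+1) q j) /\
  practical (\prod_(1 <= j < k.+1) q j).
Proof.
elim: k => [|k IH] q_pr q_incr q1 q_gap.
  rewrite big_geq //; split; last exact: practical1.
  by apply/squarefreeP; split=> // d; rewrite dvdn1 => /eqP; nia.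
have [||||sqP prP] := IH.
- by move=> i ik; apply: q_pr; lia.
- by move=> i ik; apply: q_incr; lia.
- exact: q1.
- by move=> i ik; apply: q_gap; lia.
have pr : prime (q k.+1) by apply: q_pr; lia.
have lt_q j : 1 <= j <= k -> q j < q k.+1.
  have : forall i, j <= i -> 1 <= j -> i <= k -> q j < q i.+1.
    elim=> [|i IHi] ji j1 ik; first by lia.
    move: ji; rewrite leq_eqVlt => /orP[/eqP ->|ji]; first by apply: q_incr; lia.
    by apply: (@ltn_trans (q i.+1)); [apply: IHi; lia | apply: q_incr; lia].
  by move=> H /andP[j1 jk]; apply: H.
have co : coprime (\prod_(1 <= j < k.+1) q j) (q k.+1).
  apply: coprime_big_prod => j jk.
  have qj : prime (q j) by apply: q_pr; lia.
  by rewrite prime_coprime // dvdn_prime2 // neq_ltn lt_q.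
rewrite big_nat_recr //=; split.
  exact: squarefree_mul co sqP (squarefree_prime pr).
apply: practical_mul_prime => //.
- by case/squarefreeP: sqP.
- by rewrite -prime_coprime // coprime_sym.
case: k {IH q_pr q_incr sqP prP pr lt_q co} q_gap => [|k] q_gap.
  by rewrite q1 big_geq // /sigma /= big_seq1.
by apply: q_gap; lia.
Qed.

Theorem theorem5 (n k m : nat) (q : nat -> nat)
  (hk : 1 <= k) (hm : 0 < m)
  (hn : n = (\prod_(1 <= j < k.+1) q j) * m)
  (q_prime : forall i, 1 <= i <= k -> prime (q i))
  (q_incr : forall i, 1 <= i < k -> q i < q i.+1)
  (q1 : q 1 = 2)
  (q_gap : forall i, 1 <= i < k ->
     q i.+1 <= sigma (\prod_(1 <= j < i.+1) q j) + 1)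
  (q_ndvd : forall i, 1 <= i <= k -> ~~ (q i %| m))
  (n_lb : sigma (\prod_(1 <= j < k.+1) q j) < n)
  (n_ub : n < sigma (\prod_(1 <= j < k.+1) q j) * (sigma (rad m) - 1)) :
  (sigma (\prod_(1 <= j < k.+1) q j) %/ (sigma (rad m) - 1))
     ^ (num_divisors (rad m) - 1)
  <= p_dsd n.
Proof.
have [sqP prP] := prime_chain_prod q_prime q_incr q1 q_gap.
have /andP[rad_dvd sq_rad] := rad_squarefree_dvd hm.
apply: p_dsd_ge => //; first exact: leq_trans n_lb.
- by rewrite hn dvdn_mul.
- apply: coprime_big_prod => j jk; apply: coprime_dvdr rad_dvd _.
  by rewrite prime_coprime ?q_prime // q_ndvd.
- exact: ltnW.
Qed.
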